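(* Let $\mu\ge0$, $s>0$, $x_0\in\mathbb{R}^n$, and let $f:\mathbb{R}^n\to\mathbb{R}$ be continuously differentiable, $\mu$-strongly convex (possibly $\mu=0$) and $(1/s)$-smooth, with a minimizer $x^*$. Let $(X,Z)\in C^1([0,\infty),\mathbb{R}^n\times\mathbb{R}^n)$ be the solution to the unified NAG system $$\dot X=\frac{2}{t}\operatorname{cothc}\left(\frac{\sqrt\mu}{2}t\right)(Z-X),\qquad \dot Z=\frac{t}{2}\operatorname{tanhc}\left(\frac{\sqrt\mu}{2}t\right)\left(\mu X-\mu Z-\nabla f(X)\right)\qquad(t>0)$$ with $X(0)=Z(0)=x_0$. Then for all $t>0$, $$f(X(t))-f(x^* )\le\frac{2}{t^2}\operatorname{cschc}^2\left(\frac{\sqrt\mu}{2}t\right)\|x_0-x^*\|^2.$$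
   Context: $\operatorname{sinhc}(x)=\sinh(x)/x$ for $x\ne0$, $\operatorname{sinhc}(0)=1$; $\operatorname{tanhc}(x)=\operatorname{sinhc}(x)/\cosh(x)$; $\operatorname{cothc}(x)=1/\operatorname{tanhc}(x)$; $\operatorname{cschc}(x)=1/\operatorname{sinhc}(x)$. $f$ is $\mu$-strongly convex if $f(y)\ge f(x)+\langle\nabla f(x),y-x\rangle+\frac{\mu}{2}\|y-x\|^2$ for all $x,y$; $f$ is $L$-smooth if $\nabla f$ is $L$-Lipschitz. *)

(* Defs.v *)
(* R^n is ['rV[R]_n] over an arbitrary [R : realType]. *)
From mathcomp Require Import all_boot all_order all_algebra.
From mathcomp Require Import all_classical all_reals all_analysis.

Set Implicit Arguments.
Unset Strict Implicit.
Unset Printing Implicit Defensive.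

Import Order.TTheory GRing.Theory Num.Theory.
Import numFieldNormedType.Exports.

Local Open Scope classical_set_scope.
Local Open Scope ring_scope.

Section hyperbolic.
Context {R : realType}.
Implicit Types x : R.

Definition sinh x : R := (expR x - expR (- x)) / 2.

Definition cosh x : R := (expR x + expR (- x)) / 2.

Definition sinhc x : R := if x == 0 then 1 else sinh x / x.

Definition tanhc x : R := sinhc x / cosh x.

Definition cothc x : R := 1 / tanhc x.

Definition cschc x : R := 1 / sinhc x.

End hyperbolic.

Section euclidean.
Context {R : realType} {n : nat}.
Implicit Types (u v x : 'rV[R]_n) (f : 'rV[R]_n -> R).

Definition dotp u v : R := \sum_(i < n) u ord0 i * v ord0 i.

(* The library norm [`|u|] on row vectors is the sup norm, which induces the
   same topology, hence the same derivatives. *)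
Definition enorm u : R := Num.sqrt (dotp u u).

Definition grad f x : 'rV[R]_n := \row_(i < n) 'D_(delta_mx ord0 i) f x.

Definition continuously_differentiable f : Prop :=
  (forall x, differentiable f x) /\ continuous (grad f).

Definition strongly_convex (mu : R) f : Prop :=
  forall x y : 'rV[R]_n,
    f y >= f x + dotp (grad f x) (y - x) + mu / 2 * enorm (y - x) ^+ 2.

Definition smooth (L : R) f : Prop :=
  forall x y : 'rV[R]_n, enorm (grad f x - grad f y) <= L * enorm (x - y).

Definition minimizer f x : Prop := forall y : 'rV[R]_n, f x <= f y.

End euclidean.

(* C^1 on the closed half-line: the difference quotients only involve points
   of [0, +oo[, so the derivative at 0 is one-sided and the values of [X] on
   negative reals are irrelevant. *)
Definition C1_nonneg {R : realType} {V : normedModType R} (X : R -> V) : Prop :=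
  exists dX : R -> V,
    (forall t : R, 0 <= t ->
      (u - t)^-1 *: (X u - X t) @[u --> within `[0, +oo[ t^'] --> dX t) /\
    {within `[0, +oo[, continuous dX}.

Definition unified_NAG_solution {R : realType} {n : nat} (mu : R)
    (f : 'rV[R]_n -> R) (x0 : 'rV[R]_n) (X Z : R -> 'rV[R]_n) : Prop :=
  [/\ C1_nonneg X, C1_nonneg Z, X 0 = x0, Z 0 = x0 &
    forall t : R, 0 < t ->
      is_derive t 1 X
        (2 / t * cothc (Num.sqrt mu / 2 * t) *: (Z t - X t)) /\
      is_derive t 1 Z
        (t / 2 * tanhc (Num.sqrt mu / 2 * t) *:
           (mu *: X t - mu *: Z t - grad f (X t)))].

(* Main.v *)
Require Import Defs.
From mathcomp Require Import all_boot all_order all_algebra.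
From mathcomp Require Import all_classical all_reals all_analysis.
From mathcomp Require Import ring lra.
Import Order.TTheory GRing.Theory Num.Theory.
Import numFieldNormedType.Exports.
Local Open Scope ring_scope.

(** The estimate is a Lyapunov argument.  Put k = sqrt mu / 2 and
    sigma t = sinh (k t) / k, read as t when mu = 0 ([htime k t]); then
    sigma' = cosh (k t), and the system becomes
      X' = 2 cosh (k t) / sigma * (Z - X),
      Z' = sigma / (2 cosh (k t)) * (mu X - mu Z - grad f X).
    The energy
      E t = sigma^2 / 4 * (f (X t) - f xstar)
            + cosh^2 (k t) / 2 * |Z t - xstar|^2
    has both weights growing at matched rates: with A = sigma^2 / 4 one gets
    A' = sigma cosh (k t) / 2, the derivative of cosh^2 (k t) is mu A', and
    multiplying X' by A, or Z' by cosh^2 (k t), produces the same factor A'.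
    Hence E' is A' times an expression in x = X t and z = Z t alone
    ([is_derive_lyapunov]), and strong convexity between x and xstar bounds
    that expression by - mu / 2 * |z - x|^2 ([lyapunov_rate_le0]).

    So E is nonincreasing on the closed half-line
    ([lyapunov_nonincreasing]).  The first weight vanishes at 0 and the second
    is 1/2 there, so E 0 = |x0 - xstar|^2 / 2, while E t is at least its first
    term; dividing by sigma^2 / 4 gives the bound.  The coefficient of X' is
    singular at 0, so time 0 is reached only by continuity from the right
    ([C1_nonneg_right_continuous]). *)

(** * Calculus of the Euclidean inner product *)

Section inner_product.
Local Open Scope classical_set_scope.
Local Open Scope ring_scope.
Context {R : realType} {n : nat}.
Implicit Types u v w : 'rV[R]_n.

Lemma dotpC u v : dotp u v = dotp v u.
Proof. by apply: eq_bigr => i _; rewrite mulrC. Qed.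

Lemma dotpDl u v w : dotp (u + v) w = dotp u w + dotp v w.
Proof. by rewrite -big_split; apply: eq_bigr => i _; rewrite mxE mulrDl. Qed.

Lemma dotpZl a u v : dotp (a *: u) v = a * dotp u v.
Proof. by rewrite /dotp mulr_sumr; apply: eq_bigr => i _; rewrite mxE mulrA. Qed.

Lemma dotpBl u v w : dotp (u - v) w = dotp u w - dotp v w.
Proof. by rewrite dotpDl -scaleN1r dotpZl mulN1r. Qed.

Lemma dotpBr u v w : dotp u (v - w) = dotp u v - dotp u w.
Proof. by rewrite dotpC dotpBl !(dotpC _ u). Qed.

Lemma dotpZr a u v : dotp u (a *: v) = a * dotp u v.
Proof. by rewrite dotpC dotpZl dotpC. Qed.

Lemma dotp_ge0 u : 0 <= dotp u u.
Proof. by apply: sumr_ge0 => i _; rewrite -expr2 sqr_ge0. Qed.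

Lemma sqr_enorm u : enorm u ^+ 2 = dotp u u.
Proof. by rewrite sqr_sqrtr // dotp_ge0. Qed.

(** Row vectors converge for the sup norm; each coordinate is continuous for
    it, so the inner product passes to the limit term by term. *)
Lemma cvg_dotp {T : Type} (F : set_system T) (FF : Filter F)
    (U V : T -> 'rV[R]_n) u v :
  U @ F --> u -> V @ F --> v -> dotp (U x) (V x) @[x --> F] --> dotp u v.
Proof.
move=> Uu Vv; rewrite /dotp; apply: cvg_big => [|i _]; first exact: add_continuous.
have coordc (W : T -> 'rV[R]_n) w :
    W @ F --> w -> W x ord0 i @[x --> F] --> w ord0 i.
  by move=> Ww; apply: (cvg_comp W (fun M => M ord0 i) Ww); exact: coord_continuous.
by apply: cvgM; apply: coordc.
Qed.

Lemma is_derive_dotp (U V : R -> 'rV[R]_n) (dU dV : 'rV[R]_n) (t : R) :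
  is_derive t 1 U dU -> is_derive t 1 V dV ->
  is_derive t 1 (fun r => dotp (U r) (V r)) (dotp dU (V t) + dotp (U t) dV).
Proof.
have coordd (W : R -> 'rV[R]_n) dW i :
    is_derive t 1 W dW -> is_derive t 1 (fun r => W r ord0 i) (dW ord0 i).
  move=> [Wt <-]; split; first exact: ((derivable_mxP _ _ _).1 Wt).
  by rewrite derive_mx // mxE.
move=> hU hV.
have -> : (fun r => dotp (U r) (V r)) =
    \sum_(i < n) ((fun r => U r ord0 i) * (fun r => V r ord0 i)).
  by rewrite fct_sumE.
rewrite -big_split; apply: is_derive_sum => i.
by apply: is_derive_eq; rewrite addrC [X in X + _]mulrC.
Qed.

(** The partial derivatives of a differentiable function determine its
    differential, by expanding the direction in the canonical basis. *)
Lemma diff_grad (f : 'rV[R]_n -> R) x v :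
  differentiable f x -> 'd f x v = dotp (grad f x) v.
Proof.
move=> df; rewrite {1}(row_sum_delta v) linear_sum; apply: eq_bigr => i _.
by rewrite linearZ /= mxE deriveE // mulrC.
Qed.

Lemma is_derive_comp_grad (f : 'rV[R]_n -> R) (U : R -> 'rV[R]_n) dU (t : R) :
  differentiable f (U t) -> is_derive t 1 U dU ->
  is_derive t 1 (f \o U) (dotp (grad f (U t)) dU).
Proof.
move=> df [Ut <-]; have dUt := (derivable1_diffP _ _).1 Ut.
have dfU := differentiable_comp dUt df.
split; first exact/derivable1_diffP.
by rewrite deriveE // diff_comp //= diff_grad // -deriveE.
Qed.

End inner_product.

(** * Hyperbolic time *)

Section hyperbolic_time.
Context {R : realType}.
Implicit Types k t : R.

(** This is sinh (k t) / k, continued by t at k = 0, so that the case mu = 0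
    needs no separate treatment. *)
Definition htime k t : R := t * sinhc (k * t).

Lemma htime0l t : htime 0 t = t.
Proof. by rewrite /htime mul0r /sinhc eqxx mulr1. Qed.

Lemma htime0r k : htime k 0 = 0.
Proof. by rewrite /htime mul0r. Qed.

Lemma mul_htime k t : k * htime k t = sinh (k * t).
Proof.
rewrite /htime /sinhc mulrA; case: eqVneq => [->|kt0]; last by rewrite mulrC divfK.
by rewrite mul0r /sinh oppr0 subrr mul0r.
Qed.

Lemma cosh_gt0 t : 0 < cosh t.
Proof. by rewrite divr_gt0 // addr_gt0 ?expR_gt0. Qed.

Lemma cosh0 : cosh (0 : R) = 1.
Proof. by rewrite /cosh oppr0 expR0; lra. Qed.

Lemma htime_gt0 k t : 0 <= k -> 0 < t -> 0 < htime k t.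
Proof.
rewrite le0r => /predU1P[->|k0] t0; first by rewrite htime0l.
rewrite -(pmulr_rgt0 _ k0) mul_htime divr_gt0 // subr_gt0 ltr_expR.
by rewrite gtrN // mulr_gt0.
Qed.

Lemma is_derive_scale k t : is_derive t 1 (fun u : R => k * u) k.
Proof.
by apply: is_derive_eq; rewrite [_ *: _]mulr1.
Qed.

Lemma is_derive_expR_scale k t :
  is_derive t 1 (fun u => expR (k * u)) (k * expR (k * t)).
Proof.
rewrite mulrC; apply: (is_derive1_comp (f := expR)).
exact: is_derive_scale.
Qed.

Lemma is_derive_cosh_scale k t :
  is_derive t 1 (fun u => cosh (k * u)) (k * sinh (k * t)).
Proof.
have -> : (fun u => cosh (k * u)) =
    2^-1 *: ((fun u => expR (k * u)) + (fun u => expR (- k * u))).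
  apply/funext => u.
  by rewrite /cosh [LHS]mulrC -mulNr.
have := is_deriveZ 2^-1 (is_deriveD (is_derive_expR_scale k t)
  (is_derive_expR_scale (- k) t)).
by move=> /is_derive_eq; apply; rewrite /sinh -[LHS]/(_ * _) !mulNr; field.
Qed.

Lemma is_derive_sinh_scale k t :
  is_derive t 1 (fun u => sinh (k * u)) (k * cosh (k * t)).
Proof.
have -> : (fun u => sinh (k * u)) =
    2^-1 *: ((fun u => expR (k * u)) - (fun u => expR (- k * u))).
  apply/funext => u.
  by rewrite /sinh [LHS]mulrC -mulNr.
have := is_deriveZ 2^-1 (is_deriveB (is_derive_expR_scale k t)
  (is_derive_expR_scale (- k) t)).
by move=> /is_derive_eq; apply; rewrite /cosh -[LHS]/(_ * _) !mulNr; field.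
Qed.

(** The formula sinh (k t) / k breaks down at k = 0, where [htime] is the
    identity; the derivative has the same expression in both cases. *)
Lemma is_derive_htime k t : is_derive t 1 (htime k) (cosh (k * t)).
Proof.
have [->|k0] := eqVneq k 0.
  rewrite mul0r cosh0 (_ : htime 0 = id) //; first exact: is_derive_id.
  by apply/funext => u; rewrite htime0l.
have -> : htime k = k^-1 *: (fun u => sinh (k * u)).
  by apply/funext => u; rewrite -[RHS]/(k^-1 * _) -mul_htime mulKf.
by apply: (is_derive_eq (is_deriveZ k^-1 (is_derive_sinh_scale k t))); exact: mulKf.
Qed.

End hyperbolic_time.

(** * Continuity at the initial time *)

Section right_continuity.
Local Open Scope classical_set_scope.
Local Open Scope ring_scope.

(** The difference quotient at 0 has a limit, so X u - X 0, which is u times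
    that quotient, tends to 0. *)
Lemma C1_nonneg_right_continuous (R : realType) (V : normedModType R)
    (X : R -> V) : C1_nonneg X -> X u @[u --> 0^'+] --> X 0.
Proof.
move=> [dX [dX0 _]].
have quot : (u - 0)^-1 *: (X u - X 0) @[u --> 0^'+] --> dX 0.
  apply: cvg_trans (dX0 0 (lexx 0)); apply: cvg_app.
  (* Points to the right of 0 are nonzero points of the closed half-line. *)
  move=> A A0; have {}A0 : \forall u \near (0 : R), u != 0 -> [set` `[0, +oo[] u -> A u :=
    A0.
  rewrite -[nbhs _ _]/(\forall u \near (0 : R), 0 < u -> A u).
  apply: filterS A0 => u h u0; apply: h; first by rewrite gt_eqF.
  by rewrite /= in_itv /= andbT ltW.
have -> : X 0 = X 0 + 0 *: dX 0 by rewrite scale0r addr0.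
have main : X 0 + u *: ((u - 0)^-1 *: (X u - X 0)) @[u --> 0^'+] -->
    X 0 + 0 *: dX 0.
  apply: cvgD; first exact: cvg_cst.
  by apply: cvgZ => //; apply: cvg_at_right_filter; exact: cvg_id.
apply: cvg_trans main; apply: near_eq_cvg; near=> u.
have u0 : u != 0 by rewrite gt_eqF.
by rewrite subr0 scalerA divff // scale1r addrC subrK.
Unshelve. all: by end_near. Qed.

End right_continuity.

(** * The Lyapunov function *)

Section lyapunov.
Context {R : realType} {n : nat}.
Variables (mu k : R) (f : 'rV[R]_n -> R) (xstar : 'rV[R]_n).
Variables (X Z : R -> 'rV[R]_n).
Hypotheses (hmu : 0 <= mu) (k_ge0 : 0 <= k) (muE : mu = 4 * k ^+ 2).
Hypothesis (df : forall x, differentiable f x).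
Hypothesis hconv : strongly_convex mu f.


Definition lyapunov (t : R) : R :=
  htime k t ^+ 2 / 4 * (f (X t) - f xstar) +
  cosh (k * t) ^+ 2 / 2 * dotp (Z t - xstar) (Z t - xstar).

(** Write a = z - xstar, b = z - x and g = grad f x, so that
    xstar - x = b - a.  Strong convexity bounds f x - f xstar by
    <g, a - b> - mu / 2 |b - a|^2; the terms in g cancel, and so do those in
    |a|^2 and <a, b>, leaving - mu / 2 |b|^2. *)
Lemma lyapunov_rate_le0 (x z : 'rV[R]_n) :
  f x - f xstar + dotp (grad f x) (z - x) +
  mu / 2 * dotp (z - xstar) (z - xstar) +
  dotp (z - xstar) (mu *: x - mu *: z - grad f x) <= 0.
Proof.
have := hconv x xstar; rewrite sqr_enorm.
have -> : xstar - x = (z - x) - (z - xstar).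
  by rewrite opprB [RHS]addrC addrA subrK.
have -> : mu *: x - mu *: z = - mu *: (z - x).
  by rewrite -scalerBr scaleNr -scalerN opprB.
move: (z - xstar) (z - x) (grad f x) => a b g.
rewrite !(dotpBl, dotpBr, dotpZr) (dotpC a g) (dotpC b a).
have := mulr_ge0 hmu (dotp_ge0 b).
lra.
Qed.

(** The coefficients of the system are 2 cosh (k t) / sigma and
    sigma / (2 cosh (k t)); against the weights sigma^2 / 4 and cosh^2 (k t)
    both leave the factor sigma cosh (k t) / 2.  The second weight contributes
    the same factor since k sinh (k t) = k^2 sigma and 4 k^2 = mu. *)
Lemma is_derive_lyapunov (t : R) : 0 < t ->
  is_derive t 1 X (2 / t * cothc (k * t) *: (Z t - X t)) ->
  is_derive t 1 Z
    (t / 2 * tanhc (k * t) *: (mu *: X t - mu *: Z t - grad f (X t))) ->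
  is_derive t 1 lyapunov (htime k t * cosh (k * t) / 2 *
    (f (X t) - f xstar + dotp (grad f (X t)) (Z t - X t) +
     mu / 2 * dotp (Z t - xstar) (Z t - xstar) +
     dotp (Z t - xstar) (mu *: X t - mu *: Z t - grad f (X t)))).
Proof.
move=> t0 dX dZ.
have s0 := htime_gt0 k t k_ge0 t0; have c0 := cosh_gt0 (k * t).
have tE : t != 0 by rewrite gt_eqF.
have sE : htime k t != 0 by rewrite gt_eqF.
have cE : cosh (k * t) != 0 by rewrite gt_eqF.
have scE : sinhc (k * t) = htime k t / t by rewrite /htime [RHS]mulrC mulKf.
have cothE : 2 / t * cothc (k * t) = 2 * cosh (k * t) / htime k t.
  by rewrite /cothc /tanhc scE; field; rewrite tE cE sE.
have tanhE : t / 2 * tanhc (k * t) = htime k t / (2 * cosh (k * t)).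
  by rewrite /tanhc scE; field; rewrite tE cE.
have dfX : is_derive t 1 (fun u => f (X u) - f xstar) _ :=
  is_deriveB (is_derive_comp_grad f X _ t (df _) dX) (is_derive_cst (f xstar) t 1).
have dZx : is_derive t 1 (fun u => Z u - xstar) _ :=
  is_deriveB dZ (is_derive_cst xstar t 1).
have dZZ := is_derive_dotp _ _ _ _ t dZx dZx.
have dA := is_deriveX 2 (is_derive_htime k t).
have dB := is_deriveX 2 (is_derive_cosh_scale k t).
have d1 := is_deriveM dA dfX.
have d2 := is_deriveM dB dZZ.
have -> : lyapunov = 4^-1 *: (htime k ^+ 2 * (fun u => f (X u) - f xstar)) +
    2^-1 *: ((fun u => cosh (k * u)) ^+ 2 *
             (fun u => dotp (Z u - xstar) (Z u - xstar))).
  apply/funext => u.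
  rewrite -[RHS]/(4^-1 * (htime k u ^+ 2 * (f (X u) - f xstar)) +
    2^-1 * (cosh (k * u) ^+ 2 * dotp (Z u - xstar) (Z u - xstar))).
  by rewrite /lyapunov; field.
apply: (is_derive_eq (is_deriveD (is_deriveZ 4^-1 d1) (is_deriveZ 2^-1 d2))).
rewrite cothE tanhE !subr0 !dotpZr dotpZl (dotpC _ (Z t - xstar)) -mul_htime.
rewrite -[(htime k ^+ 2) t]/(htime k t ^+ 2).
rewrite -[((fun u => cosh (k * u)) ^+ 2) t]/(cosh (k * t) ^+ 2) /GRing.scale /=.
rewrite muE.
by field; rewrite sE cE.
Qed.

Lemma lyapunov_nonincreasing :
  C1_nonneg X -> C1_nonneg Z ->
  (forall t : R, 0 < t ->
    is_derive t 1 X (2 / t * cothc (k * t) *: (Z t - X t)) /\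
    is_derive t 1 Z
      (t / 2 * tanhc (k * t) *: (mu *: X t - mu *: Z t - grad f (X t)))) ->
  forall t : R, 0 <= t -> lyapunov t <= lyapunov 0.
Proof.
move=> X1 Z1 hode t t0.
have dL u (u0 : 0 < u) := is_derive_lyapunov u u0 (hode u u0).1 (hode u u0).2.
apply: (ler0_derive1_nincry (a := 0)) => // [u|u|].
- by rewrite in_itv /= andbT => /dL[].
- rewrite in_itv /= andbT => u0; rewrite derive1E; have [_ ->] := dL u u0.
  rewrite mulr_ge0_le0 ?lyapunov_rate_le0 //.
  by rewrite divr_ge0 // mulr_ge0 // ltW ?htime_gt0 ?cosh_gt0.
apply/continuous_within_itvcyP; split.
  move=> u; rewrite in_itv /= andbT => /dL[du _].
  exact/differentiable_continuous/derivable1_diffP.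
have right_cont (g : R -> R) (dg : R) :
    is_derive (0 : R) 1 g dg -> (g u @[u --> 0^'+] --> g 0)%classic.
  move=> [g0 _]; apply: cvg_at_right_filter.
  exact/differentiable_continuous/derivable1_diffP.
have X0 := C1_nonneg_right_continuous R _ X X1.
have Z0 := C1_nonneg_right_continuous R _ Z Z1.
have hs := right_cont _ _ (is_derive_htime k 0).
have hc := right_cont _ _ (is_derive_cosh_scale k 0).
have fX : (f (X u) @[u --> 0^'+] --> f (X 0))%classic.
  by apply: (cvg_comp X f X0); exact: (differentiable_continuous (df (X 0))).
rewrite /lyapunov.
apply: cvgD.
  apply: cvgM; last by apply: cvgB => //; exact: cvg_cst.
  by apply: cvgM; [exact: (cvgM hs hs) | exact: cvg_cst].
apply: cvgM; last first.
  by apply: cvg_dotp; apply: cvgB => //; exact: cvg_cst.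
by apply: cvgM; [exact: (cvgM hc hc) | exact: cvg_cst].
Qed.

End lyapunov.

Theorem corollary8 (R : realType) (n : nat) (mu s : R) (x0 : 'rV[R]_n)
    (f : 'rV[R]_n -> R) (xstar : 'rV[R]_n) (X Z : R -> 'rV[R]_n)
    (hmu : 0 <= mu) (hs : 0 < s)
    (hC1 : continuously_differentiable f)
    (hconv : strongly_convex mu f)
    (hsmooth : smooth (1 / s) f)
    (hmin : minimizer f xstar)
    (hsol : unified_NAG_solution mu f x0 X Z) :
  forall t : R, 0 < t ->
    f (X t) - f xstar <=
      2 / t ^+ 2 * cschc (Num.sqrt mu / 2 * t) ^+ 2 * enorm (x0 - xstar) ^+ 2.
Proof.
case: hsol => X1 Z1 X0 Z0 hode t t0.
set k := Num.sqrt mu / 2.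
have k0 : 0 <= k by rewrite divr_ge0 ?sqrtr_ge0.
have muE : mu = 4 * k ^+ 2 by rewrite /k expr_div_n sqr_sqrtr //; field.
have := lyapunov_nonincreasing mu k f xstar X Z hmu k0 muE hC1.1 hconv X1 Z1
  hode t (ltW t0).
have s0 := htime_gt0 k t k0 t0.
rewrite /lyapunov htime0r mulr0 cosh0 Z0 sqr_enorm.
have sE : t * sinhc (k * t) = htime k t by [].
have -> : 2 / t ^+ 2 * cschc (k * t) ^+ 2 = 2 / htime k t ^+ 2.
  by rewrite -sE /cschc div1r exprVn exprMn [in RHS]invfM mulrA.
have : 0 <= cosh (k * t) ^+ 2 / 2 * dotp (Z t - xstar) (Z t - xstar).
  by rewrite mulr_ge0 ?dotp_ge0 // divr_ge0 // sqr_ge0.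
move=> c0 hL.
rewrite mulrAC ler_pdivlMr ?exprn_gt0 //.
lra.
Qed.
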